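(* Let $G=(V,E)$ be a connected finite graph with edge set $E=\{e_1,\dots,e_m\}$. Let $\alpha\in(0,1)$ and $\mathbf{w}_0=(w_{0,e_1},\dots,w_{0,e_m})\in\mathbb{R}^m_+=\{\mathbf{w}=(w_{e_1},\dots,w_{e_m})\in\mathbb{R}^m: w_{e_j}>0,\ j=1,\dots,m\}$ be fixed. Then the entropy flow $$w_e'(t)=\mathfrak{D}_e^\alpha(t)\ \ (t>0),\qquad w_e(t)>0\ \ (t>0),\qquad w_e(0)=w_{0,e},\qquad \text{for all } e\in E,$$ where $\mathfrak{D}_e^\alpha(t)$ is the entropy of the edge $e$ computed with respect to the weight $\mathbf{w}(t)=(w_{e_1}(t),\dots,w_{e_m}(t))$, has a unique solution $\mathbf{w}(t)$ for $t\in[0,+\infty)$. Furthermore, either (i) $\lim_{t\to+\infty}w_{e_j}(t)=+\infty$ for all $1\le j\le m$; or (ii) there exist constants $w_{e_j}^\ast>0$ such that $$\lim_{t\to+\infty}w_{e_j}(t)=w_{e_j}^\ast,\qquad \lim_{t\to+\infty}\mathfrak{D}_{e_j}^\alpha(t)=\mathfrak{D}_{e_j}^\ast=0\qquad\text{for all } 1\le j\le m,$$ where $\mathfrak{D}_{e_j}^\ast$ is the entropy of $e_j$ computed with respect to the weight $\mathbf{w}^\ast=(w_{e_1}^\ast,\dots,w_{e_m}^\ast)$.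
   Context: Graphs are undirected and simple (no loops, no multiple edges). A weight is a function $w:E\to(0,+\infty)$, identified with a vector $\mathbf{w}\in\mathbb{R}^m_+$; $w_{xy}=w_{yx}$ denotes the weight of the edge $xy$, and $x\sim y$ means $xy\in E$. For $A\subset V$ and $x\in V$, $x\sim A$ means that $x\notin A$ and there is $a\in A$ with $x\sim a$; $x\not\sim A$ means that $x\sim A$ fails. Neighbor sets: for $x\in V$, $N_0(x)=\{x\}$, $N_1(x)=\{u\in V:u\sim N_0(x)\}$ and, for $j\ge 2$, $N_j(x)=\{u\in V: u\sim\bigcup_{k=0}^{j-1}N_k(x)\}$ (so $N_j(x)$ is the set of vertices at combinatorial distance $j$ from $x$). Set $n_x=\max\{j:N_j(x)\neq\varnothing\}$. Outward walk probability with respect to $\mathbf{w}$: for $z\in N_\ell(x)$, $\ell\ge1$, $$\mathscr{P}(x,z)=\sum_{(z_0,z_1,\dots,z_\ell)}\ \prod_{k=1}^{\ell}\frac{w_{z_{k-1}z_k}}{\sum_{u\in N_k(x)}w_{z_{k-1}u}},$$ where the sum is over all outward paths from $x$ to $z$, i.e. sequences with $z_0=x$, $z_\ell=z$, $z_k\in N_k(x)$ for $1\le k\le \ell-1$, and $z_{k-1}z_k\in E$ for $1\le k\le\ell$; in the denominators $w_{z_{k-1}u}=0$ if $z_{k-1}$ is not adjacent to $u$. In particular $\mathscr{P}(x,z)=w_{xz}/\sum_{u\in N_1(x)}w_{xu}$ for $z\in N_1(x)$. $\alpha$-lazy outward random walk: for $\alpha\in(0,1)$ and $x\in V$, $\mathsf{R}_x^\alpha$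 is the probability measure on $V$ given by $\mathsf{R}_x^\alpha(x)=\alpha$ and, for $z\in N_j(x)$ with $1\le j\le n_x$, $$\mathsf{R}_x^\alpha(z)=\begin{cases}(1-\alpha)^j\alpha\,\mathscr{P}(x,z) & \text{if } z\sim N_{j+1}(x),\\ (1-\alpha)^j\,\mathscr{P}(x,z) & \text{if } z\not\sim N_{j+1}(x).\end{cases}$$ (It is strictly positive on $V$ and sums to $1$.) KL divergence: $\mathcal{D}_{KL}(P,Q)=\sum_{z\in V}P(z)\log\frac{P(z)}{Q(z)}$. Entropy of an edge $e=xy\in E$ with respect to the weight $\mathbf{w}$: $\mathfrak{D}_e^\alpha=\mathcal{D}_{KL}(\mathsf{R}_x^\alpha,\mathsf{R}_y^\alpha)+\mathcal{D}_{KL}(\mathsf{R}_y^\alpha,\mathsf{R}_x^\alpha)$, where $\mathsf{R}_x^\alpha,\mathsf{R}_y^\alpha$ are computed with respect to $\mathbf{w}$. A solution on $[0,+\infty)$ is a function $\mathbf{w}:[0,+\infty)\to\mathbb{R}^m$, continuous on $[0,+\infty)$ and differentiable for $t>0$, satisfying the stated system. *)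

(* Defs.v *)
From HB Require Import structures.
From mathcomp Require Import all_boot all_order all_algebra.
From mathcomp Require Import all_classical all_reals all_analysis.

Set Implicit Arguments.
Unset Strict Implicit.
Unset Printing Implicit Defensive.

Import Order.TTheory GRing.Theory Num.Theory.
Import numFieldNormedType.Exports.

Local Open Scope ring_scope.

(* A graph on the finite vertex type V is given by its set E of edges, an edge
   xy being the unordered pair [set x; y]: there are no multiple edges, and
   [simple_graph] excludes loops. *)
Section Graph.
Variables (V : finType) (E : {set {set V}}).

Definition simple_graph : Prop := forall f, f \in E -> #|f| = 2%N.

Definition adj : rel V := fun x y => [set x; y]%SET \in E.

Definition connected_graph : Prop := forall x y, connect adj x y.

Definition adj_set (x : V) (A : {set V}) : bool :=
  (x \notin A) && [exists a in A, adj x a].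

(* [ball x j] is the union of N_0(x), ..., N_j(x), see [ballE]. *)
Fixpoint ball (x : V) (j : nat) : {set V} :=
  if j is i.+1 then (ball x i :|: [set u | adj_set u (ball x i)])%SET
  else [set x]%SET.

Definition nbr (x : V) (j : nat) : {set V} :=
  if j is i.+1 then [set u | adj_set u (ball x i)]%SET else [set x]%SET.

Lemma ballE x j : ball x j = (\bigcup_(k < j.+1) nbr x k)%SET.
Proof.
elim: j => [|j IHj]; first by rewrite big_ord_recr big_ord0 /= finset.set0U.
by rewrite big_ord_recr /= -IHj.
Qed.

(* The j such that z belongs to N_j(x), see [levelP]; it is #|V| when there is
   no such j, which does not happen in a connected graph. *)
Definition level (x z : V) : nat :=
  find (fun j => z \in nbr x j) (iota 0 #|V|).

Lemma ball_mono x i j : (i <= j)%N -> ball x i \subset ball x j.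
Proof.
move=> /subnK <-; elim: (j - i)%N => // k IHk.
by apply: (fintype.subset_trans IHk); rewrite addSn /= finset.subsetUl.
Qed.

Lemma nbr_ball x j : nbr x j \subset ball x j.
Proof. by case: j => [|j] //=; rewrite finset.subsetUr. Qed.

Lemma nbr_inj x z i j : z \in nbr x i -> z \in nbr x j -> i = j.
Proof.
have lt a b : (a < b)%N -> z \in nbr x a -> z \notin nbr x b.
  case: b => // b ab za; rewrite /= inE negb_and negbK.
  by rewrite (fintype.subsetP (@ball_mono x a b ab)) // (fintype.subsetP (nbr_ball x a)).
move=> zi zj; case: (ltngtP i j) => // h; first by have := lt _ _ h zi; rewrite zj.
by have := lt _ _ h zj; rewrite zi.
Qed.

Lemma nbr_card x z j : z \in nbr x j -> (j < #|V|)%N.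
Proof.
move=> zj.
have empty i k : nbr x i.+1 = finset.set0 -> nbr x (k + i.+1) = finset.set0.
  move=> e0; have st : ball x (k + i) = ball x i /\ nbr x (k + i).+1 = finset.set0.
    elim: k => [|k [bk nk]] //; rewrite addSn.
    have b' : ball x (k + i).+1 = ball x i.
      by rewrite -bk; move: nk => /= ->; rewrite finset.setU0.
    by split => //=; move: b' e0 => /= -> ->.
  by rewrite addnS; case: st.
suff: (j < #|ball x j|)%N by move/leq_trans; apply; rewrite max_card.
have : forall i, (i <= j)%N -> (i < #|ball x i|)%N.
  elim=> [|i IHi] ij; first by rewrite /= cards1.
  apply: (leq_ltn_trans (IHi (ltnW ij))); apply: proper_card.
  rewrite properE ball_mono //=; apply/negP => sub.
  have n0 : nbr x i.+1 = finset.set0.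
    apply/finset.setP => u; rewrite [RHS]inE; apply/negP => ui.
    have ub : u \in ball x i by rewrite (fintype.subsetP sub) // inE ui orbT.
    by move: ui; rewrite /= inE /adj_set ub.
  by have := empty _ (j - i.+1)%N n0; rewrite subnK // => e; rewrite e inE in zj.
exact.
Qed.

Lemma levelP x z j : z \in nbr x j -> level x z = j.
Proof.
move=> zj; have jV := nbr_card zj.
have h : has (fun j => z \in nbr x j) (iota 0 #|V|).
  by apply/hasP; exists j => //; rewrite mem_iota.
have := nth_find 0%N h; rewrite nth_iota ?add0n; last first.
  by have := h; rewrite has_find size_iota.
by move=> zl; exact: (nbr_inj zl zj).
Qed.

(* The sequence z_0, ..., z_l is an outward path from x to z = z_l. *)
Definition outward_path (x z : V) (l : nat) (p : l.+1.-tuple V) : bool :=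
  [&& nth x p 0 == x, nth x p l == z,
      [forall k : 'I_l, (0 < k)%N ==> (nth x p k \in nbr x k)] &
      [forall k : 'I_l, adj (nth x p k) (nth x p k.+1)]].

End Graph.

Arguments outward_path {V} E x z l p.

Definition edge (V : finType) (E : {set {set V}}) : finType := {f | f \in E}.

Section Entropy.
Variables (R : realType) (V : finType) (E : {set {set V}}).
Implicit Types (alpha : R) (w : edge E -> R).

(* w_{xy}, with value 0 when x and y are not adjacent. *)
Definition pair_weight w (x y : V) : R :=
  if insub [set x; y]%SET is Some f then w f else 0.

Definition outward_prob w (x z : V) : R :=
  \sum_(p : (level E x z).+1.-tuple V | outward_path E x z _ p)
    \prod_(k < level E x z)
      (pair_weight w (nth x p k) (nth x p k.+1) /
       \sum_(u in nbr E x k.+1) pair_weight w (nth x p k) u).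

Definition lazy_walk alpha w (x z : V) : R :=
  if z == x then alpha else
  let j := level E x z in
  (1 - alpha) ^+ j * (if adj_set E z (nbr E x j.+1) then alpha else 1)
    * outward_prob w x z.

Definition KL (P Q : V -> R) : R := \sum_z P z * ln (P z / Q z).

(* For an edge xy this is KL(R_x, R_y) + KL(R_y, R_x), see [edge_entropyE];
   summing over the ordered pairs of endpoints avoids orienting the edge. *)
Definition edge_entropy alpha w (f : edge E) : R :=
  \sum_(x in val f) \sum_(y in val f | y != x)
    KL (lazy_walk alpha w x) (lazy_walk alpha w y).

Lemma edge_entropyE alpha w (f : edge E) x y :
  val f = [set x; y]%SET -> x != y ->
  edge_entropy alpha w f = KL (lazy_walk alpha w x) (lazy_walk alpha w y)
                         + KL (lazy_walk alpha w y) (lazy_walk alpha w x).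
Proof.
move=> fxy xy; rewrite /edge_entropy fxy big_setU1 ?inE //= big_set1.
congr (_ + _).
  rewrite (big_pred1 y) // => u /=; rewrite !inE.
  by case: (eqVneq u x) => [->|_] /=; rewrite ?andbT // (negbTE xy).
rewrite (big_pred1 x) // => u /=; rewrite !inE.
case: (eqVneq u y) => [->|_] /=; last by rewrite orbF andbT.
by rewrite andbF eq_sym (negbTE xy).
Qed.

Local Open Scope classical_set_scope.
Local Open Scope ring_scope.

Definition flow_solution alpha (w0 : edge E -> R) (w : R -> edge E -> R) : Prop :=
  [/\ forall f, {within `[0, +oo[, continuous (fun t : R => w t f)},
      forall f (t : R), 0 < t ->
        is_derive t 1 (fun s : R => w s f) (edge_entropy alpha (w t) f),
      forall f (t : R), 0 < t -> 0 < w t f &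
      forall f, w 0 f = w0 f].

End Entropy.

(* Main.v *)
(* Write R_x(z) as a function of the weight w. It is built from the coordinates
   of w by sums, products and quotients of nonnegative terms, so ln R_x(z) is
   Lipschitz for Thompson's metric max_e |ln w_e - ln w'_e|. On the set
   {w >= w0}, which is invariant because every entropy is nonnegative, the
   entropy therefore grows at most linearly and is Lipschitz with a constant at
   most linear in |w|. Picard iteration, measured with the doubly exponential
   weight exp(2 A e^(Bt)), then converges on the whole half line without any
   truncation or continuation argument, and the same contraction estimate gives
   uniqueness.

   Each w_e is nondecreasing. Suppose that xz stays bounded while xy does not:
   then R_x(z) <= w_xz / w_xy tends to 0 whereas R_z(z) = alpha, so the entropy
   of xz is eventually bounded below by a positive constant and w_xz is
   unbounded, a contradiction. By connectedness the edges are all bounded or all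
   unbounded; in the first case w converges, and a positive limit of an entropy
   would again make the edge unbounded. *)
Require Import Defs.
From HB Require Import structures.
From mathcomp Require Import all_boot all_order all_algebra.
From mathcomp Require Import all_classical all_reals all_analysis.
From mathcomp Require Import ring lra.

Import Order.TTheory GRing.Theory Num.Theory.
Import numFieldNormedType.Exports.

Set Implicit Arguments.
Unset Strict Implicit.
Unset Printing Implicit Defensive.

Local Open Scope classical_set_scope.
Local Open Scope ring_scope.

(** * Global Cauchy problem for a nonnegative field of linear growth *)

(** The mean value theorem for [g - f]. Derivatives are asked on the open interval only, since at
    time [0] the flow is merely continuous. *)
Lemma increment_le (R : realType) (f g df dg : R -> R) (a b : R) :
  a <= b ->
  {within `[a, b], continuous f} -> {within `[a, b], continuous g} ->
  (forall t, a < t < b -> is_derive t 1 f (df t)) ->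
  (forall t, a < t < b -> is_derive t 1 g (dg t)) ->
  (forall t, a < t < b -> df t <= dg t) ->
  f b - f a <= g b - g a.
Proof.
rewrite le_eqVlt => /predU1P[->|ab] cf cg Df Dg dfg; first by rewrite !subrr.
have cgf : {within `[a, b], continuous (g - f)}.
  by move=> x; exact: (continuousB (cg x) (cf x)).
have Dgf t : t \in `]a, b[%R -> is_derive t 1 (g - f) (dg t - df t).
  rewrite in_itv /= => tab.
  by have ? := Df _ tab; have ? := Dg _ tab; exact: is_deriveB.
have [c] := MVT ab Dgf cgf.
rewrite in_itv /= => /dfg dc /= e.
rewrite -subr_ge0; have -> : g b - g a - (f b - f a) = (g - f) b - (g - f) a.
  by rewrite !fctE; ring.
by rewrite e mulr_ge0 ?subr_ge0 // ltW.
Qed.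

Lemma increment_norm_le (R : realType) (f g df dg : R -> R) (a b : R) :
  a <= b ->
  {within `[a, b], continuous f} -> {within `[a, b], continuous g} ->
  (forall t, a < t < b -> is_derive t 1 f (df t)) ->
  (forall t, a < t < b -> is_derive t 1 g (dg t)) ->
  (forall t, a < t < b -> `|df t| <= dg t) ->
  `|f b - f a| <= g b - g a.
Proof.
move=> ab cf cg Df Dg dfg; rewrite ler_norml; apply/andP; split; last first.
  apply: (@increment_le _ _ _ df dg) => // t tab.
  by apply: le_trans (dfg _ tab); rewrite ler_norm.
have cNf : {within `[a, b], continuous (- f)}.
  by move=> x; exact: (continuousN (cf x)).
rewrite lerNl; have -> : - (f b - f a) = (- f) b - (- f) a.
  by rewrite !fctE; ring.
apply: (@increment_le _ _ _ (fun t => - df t) dg) => // t tab.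
  by have ? := Df _ tab; exact: is_deriveN.
by apply: le_trans (dfg _ tab); rewrite -normrN ler_norm.
Qed.

(** * Primitives of continuous functions *)

Section Primitive.
Variable R : realType.
Implicit Types (g : R -> R) (t : R).

(* Frozen on the negative axis, so that it is continuous on the whole line. *)
Definition primitive g (t : R) : R :=
  parameterized_integral lebesgue_measure (- 1) (Num.max t 0) g
  - parameterized_integral lebesgue_measure (- 1) 0 g.

Lemma primitive_le0 g t : t <= 0 -> primitive g t = 0.
Proof. by move=> t0; rewrite /primitive max_r // subrr. Qed.

(** Integrating from [-1] puts time [0] where the fundamental theorem gives differentiability, hence
    continuity of [primitive] there. *)
Lemma is_derive_integral g t : continuous g -> - 1 < t ->
  is_derive t 1 (fun s => parameterized_integral lebesgue_measure (- 1) s g) (g t).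
Proof.
move=> cg t1.
have [|||df Df] := @continuous_FTC1_closed _ g (- 1) t (t + 1) _ _ _ (cg t).
- by rewrite ltrDl.
- apply: continuous_compact_integrable; first exact: segment_compact.
  exact: continuous_subspaceT.
- exact: t1.
by split; [exact: df|rewrite -derive1E; exact: Df].
Qed.

Lemma continuous_primitive g : continuous g -> continuous (primitive g).
Proof.
move=> cg t; apply: cvgB; last exact: cvg_cst.
have cI : {for Num.max t 0, continuous (fun s =>
    parameterized_integral lebesgue_measure (- 1) s g)}.
  apply: differentiable_continuous; apply/derivable1_diffP.
  have : - 1 < Num.max t 0 by rewrite lt_max ltrN10 orbT.
  by move=> /(is_derive_integral cg)[].
apply: (@continuous_comp _ _ _ (fun t : R => Num.max t 0) _ t _ cI).
by apply: continuous_max; [exact: cvg_id|exact: cst_continuous].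
Qed.

Lemma is_derive_primitive g t : continuous g -> 0 < t ->
  is_derive t 1 (primitive g) (g t).
Proof.
move=> cg t0.
have D := is_derive_integral cg (lt_trans (ltrN10 _) t0).
have {}D := is_deriveB D (is_derive_cst
  (parameterized_integral lebesgue_measure (- 1) 0 g) t 1).
rewrite subr0 in D; apply: near_eq_is_derive D.
near=> s; rewrite /primitive !fctE max_l //.
by apply: ltW; near: s; exact: lt_nbhsr.
Unshelve. all: by end_near. Qed.

End Primitive.

(** Turns bounds on the Picard iterates with error [c / 2 ^+ n] into exact ones for the limit; with
    [a] a norm it yields equalities. *)
Lemma le0_geometric (R : realType) (a c : R) :
  (forall n, a <= c / 2 ^+ n) -> a <= 0.
Proof.
move=> ac; rewrite leNgt; apply/negP => a0.
have h : `|2^-1 : R| < 1 by rewrite ger0_norm ?invr_ge0 // invf_lt1 // ltr1n.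
have /cvgrPdist_lt/(_ _ a0)[n _ /(_ n (leqnn _))] := cvg_geometric c h.
rewrite /geometric /= sub0r normrN exprVn => /(le_lt_trans (ler_norm _)).
by rewrite ltNge ac.
Qed.

(* The sequences [u n - c / 2 ^+ n] and [u n + c / 2 ^+ n] are adjacent. *)
Lemma geometric_limit (R : realType) (u : nat -> R) (c : R) :
  (forall n, `|u n.+1 - u n| <= c / 2 ^+ n.+1) ->
  exists l, forall n, `|u n - l| <= c / 2 ^+ n.
Proof.
move=> uc.
have c0 : 0 <= c.
  by have := le_trans (normr_ge0 _) (uc 0%N); rewrite pmulr_lge0 // invr_gt0 exprn_gt0.
have half n : c / 2 ^+ n = c / 2 ^+ n.+1 + c / 2 ^+ n.+1.
  by rewrite exprS; field; rewrite expf_neq0 // pnatr_eq0.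
have bnd n : u n - c / 2 ^+ n <= u n.+1 - c / 2 ^+ n.+1 /\
             u n.+1 + c / 2 ^+ n.+1 <= u n + c / 2 ^+ n.
  have := uc n; rewrite ler_norml => /andP[]; rewrite (half n).
  by move: (c / _) => d *; lra.
have inc : {homo (fun n => u n - c / 2 ^+ n) : m n / (m <= n)%N >-> m <= n}.
  by apply/nondecreasing_seqP => n; case: (bnd n).
have dec : {homo (fun n => u n + c / 2 ^+ n) : m n / (m <= n)%N >-> n <= m}.
  by apply/nonincreasing_seqP => n; case: (bnd n).
have sep m n : u m - c / 2 ^+ m <= u n + c / 2 ^+ n.
  have [mn|/ltnW nm] := leqP m n.
    apply: le_trans (inc _ _ mn) _; rewrite lerD2l ge0_cp //.
    by rewrite mulr_ge0 // invr_ge0 exprn_ge0.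
  apply: le_trans _ (dec _ _ nm); rewrite lerD2l ge0_cp //.
  by rewrite mulr_ge0 // invr_ge0 exprn_ge0.
set S := range (fun n => u n - c / 2 ^+ n).
have ubS n : ubound S (u n + c / 2 ^+ n) by move=> _ [m _ <-].
have supS : has_sup S.
  by split; [exists (u 0%N - c / 2 ^+ 0), 0%N|exists (u 0%N + c / 2 ^+ 0)].
exists (sup S) => n; rewrite ler_distlC; apply/andP; split.
  by apply: (ub_le_sup supS.2); exists n.
by apply: ge_sup => //; exact: supS.1.
Qed.

(** * Picard iteration in a weighted norm *)

Section CauchyProblem.
Variables (R : realType) (I : finType) (F : (I -> R) -> I -> R).
Variables (w0 : I -> R) (K : R).
Implicit Types (w : I -> R) (s t : R).

Definition l1norm w : R := \sum_i `|w i|.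

Definition above w : Prop := forall i, w0 i <= w i.

Hypothesis K_gt0 : 0 < K.
Hypothesis F_ge0 : forall w i, above w -> 0 <= F w i.
Hypothesis F_growth : forall w i, above w -> F w i <= K * (1 + l1norm w).
Hypothesis F_lip : forall w w' i, above w -> above w' ->
  `|F w i - F w' i| <= K * (1 + l1norm w) * l1norm (fun i => w i - w' i).

Lemma l1norm_ge0 w : 0 <= l1norm w.
Proof. by apply: sumr_ge0. Qed.

Lemma l1norm_le w c : (forall i, `|w i| <= c) -> l1norm w <= #|I|%:R * c.
Proof.
move=> wc; apply: le_trans (ler_sum _ (fun i _ => wc i)) _.
by rewrite sumr_const mulr_natl.
Qed.

(** The constant in [F_lip] involves the first argument only, so it stays fixed when that argument
    is the limit. Serves both the continuity of the field along curves and the limit of the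
    entropies at infinity. *)
Lemma cvg_field T (G : set_system T) {FG : Filter G} (x : T -> I -> R) w i :
  above w -> (\forall t \near G, above (x t)) ->
  (forall i, x t i @[t --> G] --> w i) ->
  F (x t) i @[t --> G] --> F w i.
Proof.
move=> ww xw xcvg; apply/cvgrPdist_le => e e0.
set M := K * (1 + l1norm w).
have M0 : 0 < M by rewrite mulr_gt0 // ltr_wpDr // l1norm_ge0.
set d := e / (M * (#|I|%:R + 1)).
have n0 : 0 < #|I|%:R + 1 :> R by rewrite ltr_wpDl.
have d0 : 0 < d by rewrite divr_gt0 // mulr_gt0.
have xd : \forall t \near G, forall i, `|w i - x t i| <= d.
  by apply: filter_forall => j; have /cvgrPdist_le/(_ _ d0) := xcvg j.
near=> t.
apply: le_trans (F_lip _ ww _) _; first by near: t.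
apply: (@le_trans _ _ (M * (#|I|%:R * d))).
  rewrite ler_pM2l //; apply: l1norm_le; by near: t.
have -> : e = M * ((#|I|%:R + 1) * d) by rewrite /d; field; rewrite !gt_eqF.
by rewrite ler_pM2l // ler_pM2r // lerDl.
Unshelve. all: by end_near. Qed.

(** [H] solves [H' = B * H] with [H 0 = A] and will dominate [1 + l1norm] along every iterate. The
    growth rate [2 * B * H] of [phi] is at least twice [K * H * #|I|], the Lipschitz constant of the
    field in the coordinatewise maximum. The [+ 1] keeps [B] positive when [I] is empty. *)
Let B := K * (#|I|%:R + 1).
Let A := 1 + l1norm w0.
Let H t := A * expR (B * t).
Let phi t := expR (2 * H t).

Let B_gt0 : 0 < B. Proof. by rewrite mulr_gt0 // ltr_wpDl. Qed.
Let A_gt0 : 0 < A. Proof. by rewrite ltr_wpDr // l1norm_ge0. Qed.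
Let H_gt0 t : 0 < H t. Proof. by rewrite mulr_gt0 // expR_gt0. Qed.
Let phi_ge1 t : 1 <= phi t.
Proof. by rewrite -expR0 ler_expR mulr_ge0 // ltW. Qed.
Let phi_gt0 t : 0 < phi t. Proof. exact: expR_gt0. Qed.

Let is_derive_scale (g : R -> R) (k t dg : R) : is_derive t 1 g dg ->
  is_derive t 1 (fun s => k * g s) (k * dg).
Proof. exact: is_deriveZ. Qed.

Let is_derive_H t : is_derive t 1 H (B * H t).
Proof.
have D : is_derive t 1 (fun s => B * s) B.
  by have := is_derive_scale B (is_derive_id t 1); rewrite mulr1.
have -> : B * H t = A * (expR (B * t) * B) by rewrite /H; ring.
have D2 := @is_derive1_comp _ expR (fun s => B * s) t _ _ (is_derive_expR _) D.
exact: is_derive_scale D2.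
Qed.

Let is_derive_phi t : is_derive t 1 phi (2 * (B * H t) * phi t).
Proof.
rewrite [_ * phi t]mulrC; have D := is_derive_scale 2 (is_derive_H t).
exact: (@is_derive1_comp _ expR (fun s => 2 * H s) t _ _ (is_derive_expR _) D).
Qed.

Let derive_continuous (f df : R -> R) : (forall t, is_derive t 1 f (df t)) ->
  continuous f.
Proof.
move=> D t; apply: differentiable_continuous; apply/derivable1_diffP.
by case: (D t).
Qed.

Let continuous_H : continuous H. Proof. exact: derive_continuous is_derive_H. Qed.
Let continuous_phi : continuous phi.
Proof. exact: derive_continuous is_derive_phi. Qed.

(* Since [phi' >= 2 K #|I| H phi], one application of the integral operator
   halves the distance measured with the weight [phi]. *)
Lemma integral_contraction (a b : R -> I -> R) (u v : R -> R) (c t : R) i :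
  0 <= t -> 0 <= c ->
  (forall s, 0 < s < t -> [/\ above (a s), above (b s),
    1 + l1norm (a s) <= H s & forall j, `|a s j - b s j| <= c * phi s]) ->
  {within `[0, t], continuous u} -> {within `[0, t], continuous v} ->
  (forall s, 0 < s < t -> is_derive s 1 u (F (a s) i)) ->
  (forall s, 0 < s < t -> is_derive s 1 v (F (b s) i)) ->
  u 0 = v 0 -> `|u t - v t| <= c / 2 * phi t.
Proof.
move=> t0 c0 ab cu cv Du Dv uv0.
have cuv : {within `[0, t], continuous (u - v)}.
  by move=> x; exact: (continuousB (cu x) (cv x)).
have cphi : {within `[0, t], continuous (fun s => c / 2 * phi s)}.
  apply: continuous_subspaceT => s; apply: cvgMr; exact: continuous_phi.
have Duv s : 0 < s < t -> is_derive s 1 (u - v) (F (a s) i - F (b s) i).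
  by move=> st; exact: is_deriveB (Du _ st) (Dv _ st).
have Dphi s : 0 < s < t ->
    is_derive s 1 (fun s => c / 2 * phi s) (c / 2 * (2 * (B * H s) * phi s)).
  by move=> _; exact: is_derive_scale (is_derive_phi s).
have bnd s : 0 < s < t ->
    `|F (a s) i - F (b s) i| <= c / 2 * (2 * (B * H s) * phi s).
  move=> /ab[wa wb aH abphi].
  apply: le_trans (F_lip _ wa wb) _.
  apply: (@le_trans _ _ (K * H s * (#|I|%:R * (c * phi s)))).
    apply: ler_pM; rewrite ?l1norm_ge0 ?mulr_ge0 ?addr_ge0 ?l1norm_ge0 ?(ltW K_gt0) //.
      by rewrite ler_pM2l.
    exact: l1norm_le.
  have -> : c / 2 * (2 * (B * H s) * phi s) = B * H s * (c * phi s).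
    by field.
  rewrite mulrA ler_wpM2r ?mulr_ge0 // ?(ltW (phi_gt0 _)) // /B.
  rewrite mulrAC -[leRHS]mulrA -[leLHS]mulrA ler_pM2l // mulrC.
  by rewrite [leRHS]mulrC ler_pM2l // lerDl.
have := increment_norm_le t0 cuv cphi Duv Dphi bnd.
rewrite !fctE uv0 subrr subr0 => /le_trans; apply.
rewrite lerBlDr lerDl mulr_ge0 ?divr_ge0 //.
exact: ltW.
Qed.

Definition picard_map (x : R -> I -> R) t i : R :=
  w0 i + primitive (fun s => F (x s) i) t.

Definition picard n : R -> I -> R := iter n picard_map (fun=> w0).

Let picard_le0 n t i : t <= 0 -> picard n t i = w0 i.
Proof. by case: n => //= n t0; rewrite /picard_map primitive_le0 // addr0. Qed.

Let continuous_shift (g : R -> R) (c : R) : continuous g ->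
  continuous (fun t => c + primitive g t).
Proof.
by move=> cg t; apply: cvgD; [exact: cvg_cst|exact: continuous_primitive].
Qed.

Let is_derive_shift (g : R -> R) (c t : R) : continuous g -> 0 < t ->
  is_derive t 1 (fun t => c + primitive g t) (g t).
Proof.
move=> cg t0.
have := is_deriveD (is_derive_cst c t 1) (is_derive_primitive cg t0).
by rewrite add0r.
Qed.

Let continuous_field (x : R -> I -> R) i : (forall t, above (x t)) ->
  (forall j, continuous (x ^~ j)) -> continuous (fun t => F (x t) i).
Proof. by move=> xw cx t; apply: cvg_field => // [|j]; [near=> s|exact: cx].
Unshelve. all: by end_near. Qed.

(* [K * H / B] dominates the primitives of the fields along a curve whose norm
   is at most [H - 1]; as [#|I| * K <= B] the bound is preserved. *)
Let bounded_step (x : R -> I -> R) :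
  (forall t, above (x t)) -> (forall j, continuous (x ^~ j)) ->
  (forall t, 0 <= t -> 1 + l1norm (x t) <= H t) ->
  forall i s t, 0 <= s <= t ->
  0 <= picard_map x t i - picard_map x s i <= K / B * (H t - H s).
Proof.
move=> xw cx xH i s t /andP[s0 st]; pose y := picard_map x ^~ i.
rewrite -/(y t) -/(y s).
have cF : continuous (fun t => F (x t) i) by exact: continuous_field.
have cy : {within `[s, t], continuous y}.
  by apply: continuous_subspaceT; exact: continuous_shift.
have Dy r : s < r < t -> is_derive r 1 y (F (x r) i).
  by move=> /andP[sr _]; apply: is_derive_shift => //; exact: le_lt_trans sr.
apply/andP; split.
  have -> : 0 = cst 0 t - cst 0 s :> R by rewrite subrr.
  apply: (@increment_le _ (cst 0) y (fun=> 0) _ _ _ st _ cy _ Dy) => [|r _].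
  - by apply: continuous_subspaceT; exact: cst_continuous.
  - exact: F_ge0.
rewrite mulrBr.
have cH : {within `[s, t], continuous (fun s => K / B * H s)}.
  by apply: continuous_subspaceT => r; apply: cvgMr; exact: continuous_H.
apply: (increment_le st cy cH Dy (fun r _ => is_derive_scale (K / B) (is_derive_H r))).
move=> r /andP[sr _]; apply: le_trans (F_growth _ (xw _)) _.
rewrite mulrA divfK ?gt_eqF // ler_pM2l // xH //.
exact: le_trans (ltW sr).
Qed.

(** Summing the coordinate increments of [bounded_step] gives [1 + l1norm <= A + (H t - A)], so the
    bound by [H] reproduces itself. The last clause is a modulus of continuity uniform in [n], which
    passes to the limit. *)
Lemma picardP n :
  [/\ forall t, above (picard n t),
      forall j, continuous (fun t => picard n t j),
      forall t, 0 <= t -> 1 + l1norm (picard n t) <= H t &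
      forall i s t, 0 <= s <= t -> 0 <= picard n t i - picard n s i <= H t - H s].
Proof.
have H_homo s t : s <= t -> H s <= H t.
  by move=> st; rewrite ler_pM2l // ler_expR ler_pM2l.
have H0 : H 0 = A by rewrite /H mulr0 expR0 mulr1.
elim: n => [|n [xw cx xH _]].
  split => [t i //|j|t t0|i s t /andP[_ st]] /=.
  - exact: cst_continuous.
  - by rewrite -/A -H0; exact: H_homo.
  - by rewrite subrr lexx subr_ge0 H_homo.
have step := bounded_step xw cx xH.
(* This controls a single coordinate, the next inequality the sum of all coordinates. *)
have KB1 : K / B <= 1 by rewrite ler_pdivrMr // mul1r ler_pMr // lerDr.
have nKB1 : #|I|%:R * (K / B) <= 1.
  by rewrite mulrA ler_pdivrMr // mul1r mulrC ler_pM2l // lerDl.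
split.
- move=> t i; have [t0|/ltW t0] := leP t 0; first by rewrite picard_le0.
  have /(step i)/andP[+ _] : (0 : R) <= 0 <= t by rewrite lexx.
  by rewrite [picard_map _ 0 i]/picard_map primitive_le0 // addr0 subr_ge0.
- move=> j; apply: continuous_shift; exact: continuous_field.
- move=> t t0.
  have bnd i : `|picard n.+1 t i| <= `|w0 i| + K / B * (H t - A).
    have : 0 <= picard n.+1 t i - w0 i <= K / B * (H t - A).
      have := step i 0 t; rewrite [picard_map _ 0 i]/picard_map primitive_le0 //.
      by rewrite addr0 H0; apply; rewrite lexx.
    move: (picard n.+1 t i) (w0 i) (_ * _) => p q r /andP[? ?].
    have := ler_norm q; have := ler_norm (- q); rewrite normrN ler_norml => *.
    by apply/andP; split; lra.
  apply: le_trans (lerD (lexx 1) (ler_sum _ (fun i _ => bnd i))) _.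
  rewrite big_split /= addrA -/(l1norm w0) -/A sumr_const -mulr_natl.
  by rewrite -lerBrDl mulrA ler_piMl // subr_ge0 -H0 H_homo.
- move=> i s t st; have /andP[-> /le_trans->//] /= := step i s t st.
  by rewrite ler_piMl // subr_ge0 H_homo //; case/andP: st.
Qed.

Let is_derive_picard n s i : 0 < s ->
  is_derive s 1 (picard n.+1 ^~ i) (F (picard n s) i).
Proof.
have [xw cx _ _] := picardP n.
by move=> s0; apply: is_derive_shift => //; exact: continuous_field.
Qed.

Let within_picard n t i : {within `[0, t], continuous (picard n ^~ i)}.
Proof. by apply: continuous_subspaceT; have [_ ? _ _] := picardP n. Qed.

Let halve n t : phi t / 2 ^+ n.+1 = (2 ^+ n)^-1 / 2 * phi t.
Proof. by rewrite exprS; field; rewrite expf_neq0 // pnatr_eq0. Qed.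

Lemma picard_dist n t i :
  `|picard n.+1 t i - picard n t i| <= phi t / 2 ^+ n.+1.
Proof.
elim: n t i => [|n IHn] t i; last first.
  have [t0|/ltW t0] := leP t 0.
    by rewrite !picard_le0 // subrr normr0 divr_ge0 // ?exprn_ge0 // ltW.
  rewrite halve; apply: (@integral_contraction (picard n.+1) (picard n)
    (picard n.+2 ^~ i) (picard n.+1 ^~ i) _ _ i) => //.
  - by move=> s /andP[/ltW s0 _]; have [xw _ xH _] := picardP n.+1;
      have [yw _ _ _] := picardP n; split => // [|j]; [exact: xH|
      rewrite mulrC; exact: IHn].
  - by move=> s /andP[s0 _]; exact: is_derive_picard.
  - by move=> s /andP[s0 _]; exact: is_derive_picard.
  - by rewrite !picard_le0.
have [t0|/ltW t0] := leP t 0.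
  by rewrite !picard_le0 // subrr normr0 divr_ge0 // ?exprn_ge0 // ltW.
have -> : picard 1 t i - picard 0 t i = picard 1 t i - picard 1 0 i.
  by rewrite [picard 1 0 i]picard_le0.
have cphi : {within `[0, t], continuous (fun s => 2^-1 * phi s)}.
  by apply: continuous_subspaceT => s; apply: cvgMr; exact: continuous_phi.
have := increment_norm_le t0 (@within_picard 1 t i) cphi
  (fun s st => is_derive_picard 0 i (andP st).1)
  (fun s _ => is_derive_scale 2^-1 (is_derive_phi s)).
rewrite expr1 mulrC => inc; apply: le_trans (inc _) _ => [s /andP[s0 _]|].
  have w0w0 : above w0 by move=> j; exact: lexx.
  rewrite ger0_norm ?F_ge0 //; apply: le_trans (F_growth _ w0w0) _.
  (* [K * A] bounds the field at [w0]; the remaining factors of [phi' / 2] are at least [1]. *)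
  have -> : 2^-1 * (2 * (B * H s) * phi s) =
      K * A * ((#|I|%:R + 1) * expR (B * s) * phi s) by rewrite /B /H; field.
  rewrite -/A.
  rewrite ler_peMr ?mulr_ge0 ?(ltW K_gt0) ?(ltW A_gt0) //.
  rewrite -[leLHS]mulr1 ler_pM ?phi_ge1 // -[leLHS]mulr1 ler_pM ?lerDr //.
  by rewrite -expR0 ler_expR mulr_ge0 // ltW.
by rewrite lerBlDr lerDl mulr_ge0 ?invr_ge0 // ltW.
Qed.

(** The solution is the pointwise limit of the iterates. For uniqueness the contraction is iterated
    from a constant bound on [[0, t]]; it asks the growth bound of its first curve, so that of [x]
    serves for both. *)
Lemma cauchy_problem : exists x : R -> I -> R,
  [/\ forall t, above (x t), forall i, continuous (x ^~ i),
      forall t i, 0 < t -> is_derive t 1 (x ^~ i) (F (x t) i),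
      forall i, x 0 i = w0 i &
      forall y : R -> I -> R,
        (forall t, 0 <= t -> above (y t)) ->
        (forall i, {within `[0, +oo[, continuous (y ^~ i)}) ->
        (forall t i, 0 < t -> is_derive t 1 (y ^~ i) (F (y t) i)) ->
        (forall i, y 0 i = w0 i) ->
        forall t, 0 <= t -> forall i, y t i = x t i].
Proof.
have /choice[x' x'P] : forall ti : R * I, exists l,
    forall n, `|picard n ti.1 ti.2 - l| <= phi ti.1 / 2 ^+ n.
  by move=> [t i]; apply: geometric_limit => n; exact: picard_dist.
pose x t i := x' (t, i).
have xP n t i : `|picard n t i - x t i| <= phi t / 2 ^+ n := x'P (t, i) n.
have x_le0 t i : t <= 0 -> x t i = w0 i.
  move=> t0; apply/eqP; rewrite eq_sym -subr_eq0 -normr_le0.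
  by apply: (@le0_geometric _ _ (phi t)) => n; have := xP n t i; rewrite picard_le0.
have x_inc i s t : 0 <= s <= t -> 0 <= x t i - x s i <= H t - H s.
  move=> st; apply/andP; split; [rewrite -oppr_le0|rewrite -subr_le0];
    apply: (@le0_geometric _ _ (phi t + phi s)) => n;
    have [_ _ _ /(_ i s t st)/andP[]] := picardP n;
    have := xP n t i; have := xP n s i; rewrite !ler_norml mulrDl;
    move: (phi t / _) (phi s / _) => ? ? /andP[? ?] /andP[? ?] *; lra.
have xw t : above (x t).
  move=> i; have [t0|/ltW t0] := leP t 0; first by rewrite x_le0.
  have /(x_inc i)/andP[+ _] : (0 : R) <= 0 <= t by rewrite lexx.
  by rewrite subr_ge0 x_le0.
have x_max t i : x t i = x (Num.max t 0) i.
  by have [t0|//] := leP t 0; rewrite !x_le0.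
have cx i : continuous (x ^~ i).
  move=> t; apply/cvgrPdist_le => e e0.
  (* By [x_inc], increments of [x] are at most those of [H] at the times clipped to be
     nonnegative. *)
  have cHmax : {for t, continuous (fun t => H (Num.max t 0))}.
    apply: (@continuous_comp _ _ _ (fun t : R => Num.max t 0)); last first.
      exact: continuous_H.
    by apply: continuous_max; [exact: cvg_id|exact: cst_continuous].
  have /cvgrPdist_le/(_ _ e0) := cHmax.
  apply: filterS => s /= /(le_trans _); apply => {e e0}.
  rewrite [x t i]x_max [x s i]x_max.
  have : 0 <= Num.max t 0 by rewrite le_max lexx orbT.
  have : 0 <= Num.max s 0 by rewrite le_max lexx orbT.
  move: (Num.max t 0) (Num.max s 0) => a b b0 a0.
  wlog ab : a b a0 b0 / a <= b => [hw|].
    have [ab|/ltW ba] := leP a b; first exact: hw.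
    by rewrite distrC [leRHS]distrC; exact: hw.
  have /(x_inc i)/andP[p q] : 0 <= a <= b by rewrite a0.
  by rewrite distrC [leRHS]distrC !ger0_norm // (le_trans p).
have xH t : 0 <= t -> 1 + l1norm (x t) <= H t.
  move=> t0; rewrite -subr_le0.
  apply: (@le0_geometric _ _ (#|I|%:R * phi t)) => n.
  have [_ _ /(_ t t0) pH _] := picardP n.
  have : l1norm (x t) <= l1norm (picard n t) + #|I|%:R * (phi t / 2 ^+ n).
    rewrite mulr_natl -sumr_const -big_split /=; apply: ler_sum => i _.
    by rewrite -lerBlDl (le_trans (lerB_dist _ _)) // distrC xP.
  by rewrite mulrA; move: (_ / 2 ^+ n) pH => *; lra.
have cF i : continuous (fun t => F (x t) i) by exact: continuous_field.
have c2 n : 0 <= (2 ^+ n)^-1 :> R by rewrite invr_ge0 exprn_ge0.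
(* [picard n.+1] is close to [x] by [xP], and to [picard_map x] by one contraction. *)
have fixed t i : x t i = picard_map x t i.
  have [t0|/ltW t0] := leP t 0.
    by rewrite x_le0 // /picard_map primitive_le0 // addr0.
  apply/eqP; rewrite -subr_eq0 -normr_le0.
  apply: (@le0_geometric _ _ (phi t)) => n.
  have : `|picard n.+1 t i - picard_map x t i| <= phi t / 2 ^+ n.+1.
    rewrite halve; apply: (@integral_contraction (picard n) x (picard n.+1 ^~ i)
      (picard_map x ^~ i) _ _ i) => //.
    - move=> s /andP[/ltW s0 _]; have [pw _ pH _] := picardP n.
      by split => // [|j]; [exact: pH|rewrite mulrC].
    - by apply: continuous_subspaceT; exact: continuous_shift.
    - by move=> s /andP[s0 _]; exact: is_derive_picard.
    - by move=> s /andP[s0 _]; exact: is_derive_shift.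
    - by rewrite picard_le0 // /picard_map primitive_le0 // addr0.
  have -> : phi t / 2 ^+ n = phi t / 2 ^+ n.+1 + phi t / 2 ^+ n.+1.
    by rewrite exprS; field; rewrite expf_neq0 // pnatr_eq0.
  move=> picardE; apply: le_trans (ler_distD (picard n.+1 t i) _ _) _.
  by rewrite lerD // distrC.
have Dx t i : 0 < t -> is_derive t 1 (x ^~ i) (F (x t) i).
  move=> t0; have -> : x ^~ i = picard_map x ^~ i by apply/funext => s; exact: fixed.
  exact: is_derive_shift.
exists x; split => // [i|y yw cy Dy y0 t t0 i]; first by rewrite x_le0.
have within_y r s j : 0 <= r -> {within `[r, s], continuous (y ^~ j)}.
  move=> r0; apply: continuous_subspaceW (cy j) => z /=.
  by rewrite !in_itv /= andbT => /andP[/(le_trans r0)].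
have y_homo s j : 0 <= s <= t -> y s j <= y t j.
  move=> /andP[s0 st]; rewrite -subr_ge0 (_ : 0 = cst 0 t - cst 0 s :> R); last first.
    by rewrite subrr.
  apply: (@increment_le _ (cst 0) (y ^~ j) (fun=> 0) _ _ _ st _ (within_y _ _ _ s0) _
    (fun r rst => Dy r j (le_lt_trans s0 (andP rst).1))) => [|r /andP[sr _]].
  - by apply: continuous_subspaceT; exact: cst_continuous.
  by apply: F_ge0; apply: yw; rewrite (le_trans s0) // ltW.
(* Both curves are nondecreasing, so their total increments over [[0, t]] bound their distance
   there; this starts the iteration. *)
pose c := \sum_j (x t j - w0 j + (y t j - w0 j)).
have part0 j : 0 <= x t j - w0 j + (y t j - w0 j).
  by rewrite addr_ge0 // subr_ge0 //; [exact: xw|exact: yw].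
have c0 : 0 <= c by apply: sumr_ge0 => j _.
have base s j : 0 <= s <= t -> `|x s j - y s j| <= c.
  move=> st; apply: (@le_trans _ _ (x t j - w0 j + (y t j - w0 j))); last first.
    by rewrite /c (bigD1 j) //= lerDl sumr_ge0.
  have := y_homo s j st; have /andP[+ _] := x_inc j s t st.
  have := xw s j; have := yw s (andP st).1 j.
  by rewrite ler_norml => *; apply/andP; split; lra.
have iter n s j : 0 <= s <= t -> `|x s j - y s j| <= c / 2 ^+ n * phi s.
  elim: n s j => [|n IHn] s j st.
    by rewrite expr0 divr1 (le_trans (base _ _ st)) // ler_peMr.
  have -> : c / 2 ^+ n.+1 = c / 2 ^+ n / 2.
    by rewrite exprS; field; rewrite expf_neq0 // pnatr_eq0.
  case/andP: st => s0 st.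
  apply: (@integral_contraction x y (x ^~ j) (y ^~ j) _ _ j) => //.
  - by rewrite divr_ge0 // exprn_ge0.
  - move=> r /andP[/ltW r0 rs]; split => // [||k]; [exact: yw|exact: xH|].
    by apply: IHn; rewrite r0 (le_trans (ltW rs)).
  - by apply: continuous_subspaceT; exact: cx.
  - exact: within_y.
  - by move=> r /andP[r0 _]; exact: Dx.
  - by move=> r /andP[r0 _]; exact: Dy.
  - by rewrite y0 x_le0.
apply/eqP; rewrite eq_sym -subr_eq0 -normr_le0.
apply: (@le0_geometric _ _ (c * phi t)) => n.
by rewrite mulrAC; apply: iter; rewrite t0 lexx.
Qed.

End CauchyProblem.

(** * Regularity of the entropy *)

Section Thompson.
Variables (R : realType) (I : finType).
Implicit Types (w : I -> R) (h g : (I -> R) -> R).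

(* On the open orthant [ln (h w)] is Lipschitz for Thompson's part metric
   [max_i |ln (w i) - ln (w' i)|] (and [h] vanishes everywhere or nowhere). *)
Definition subhom h : Prop :=
  (forall w, (forall i, 0 < w i) -> 0 <= h w) /\
  exists k : nat, forall (lam : R) w w', 1 <= lam ->
    (forall i, 0 < w i) -> (forall i, 0 < w' i) ->
    (forall i, w i <= lam * w' i) -> (forall i, w' i <= lam * w i) ->
    h w <= lam ^+ k * h w'.

Lemma subhom_cst (c : R) : 0 <= c -> subhom (fun=> c).
Proof. by split=> //; exists 0%N => *; rewrite expr0 mul1r. Qed.

Lemma subhom_coord i : subhom (fun w => w i).
Proof. by split=> [w /(_ i)/ltW//|]; exists 1%N => *; rewrite expr1. Qed.

Lemma subhomD h g : subhom h -> subhom g -> subhom (fun w => h w + g w).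
Proof.
move=> [h0 [k hk]] [g0 [l gl]]; split=> [w w_gt0|].
  by rewrite addr_ge0 ?h0 ?g0.
exists (k + l)%N => lam w w' lam1 w_gt0 w'_gt0 ww' w'w.
rewrite mulrDr lerD //.
  apply: le_trans (hk _ _ _ lam1 w_gt0 w'_gt0 ww' w'w) _.
  by rewrite ler_wpM2r ?h0 // ler_weXn2l // leq_addr.
apply: le_trans (gl _ _ _ lam1 w_gt0 w'_gt0 ww' w'w) _.
by rewrite ler_wpM2r ?g0 // ler_weXn2l // leq_addl.
Qed.

Lemma subhomM h g : subhom h -> subhom g -> subhom (fun w => h w * g w).
Proof.
move=> [h0 [k hk]] [g0 [l gl]]; split=> [w w_gt0|].
  by rewrite mulr_ge0 ?h0 ?g0.
exists (k + l)%N => lam w w' lam1 w_gt0 w'_gt0 ww' w'w.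
by rewrite exprD mulrACA ler_pM ?h0 ?g0 ?hk ?gl.
Qed.

(** The condition is symmetric in [w] and [w'], so the bound is used with them exchanged. If
    [h w = 0] its inverse is [0], and [h w' = 0 < h w] is excluded by the bound itself. *)
Lemma subhomV h : subhom h -> subhom (fun w => (h w)^-1).
Proof.
move=> [h0 [k hk]]; split=> [w w_gt0|]; first by rewrite invr_ge0 h0.
exists k => lam w w' lam1 w_gt0 w'_gt0 ww' w'w.
have lamk : 0 < lam ^+ k by rewrite exprn_gt0 // (lt_le_trans ltr01).
have := hk _ _ _ lam1 w'_gt0 w_gt0 w'w ww'.
have := h0 _ w_gt0; rewrite le_eqVlt => /predU1P[<- _|hw].
  by rewrite invr0 mulr_ge0 ?invr_ge0 ?h0 // ltW.
have := h0 _ w'_gt0; rewrite le_eqVlt => /predU1P[e _|hw'].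
  have := hk _ _ _ lam1 w_gt0 w'_gt0 ww' w'w.
  by rewrite -e mulr0 leNgt hw.
by move=> le; rewrite ler_pdivlMr // mulrC ler_pdivrMr.
Qed.

Lemma subhom_sum (J : Type) (r : seq J) (P : pred J) (h : J -> (I -> R) -> R) :
  (forall j, subhom (h j)) -> subhom (fun w => \sum_(j <- r | P j) h j w).
Proof.
move=> hh; elim: r => [|j r IHr].
  by under eq_fun do rewrite big_nil; exact: subhom_cst.
under eq_fun do rewrite big_cons; case: (P j) => //; exact: subhomD.
Qed.

Lemma subhom_prod (J : Type) (r : seq J) (P : pred J) (h : J -> (I -> R) -> R) :
  (forall j, subhom (h j)) -> subhom (fun w => \prod_(j <- r | P j) h j w).
Proof.
move=> hh; elim: r => [|j r IHr].
  by under eq_fun do rewrite big_nil; exact: subhom_cst.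
under eq_fun do rewrite big_cons; case: (P j) => //; exact: subhomM.
Qed.

(** Any two points of the orthant are at finite Thompson distance: [lam] dominates all ratios in
    both directions. *)
Lemma subhom_gt0 h w w' : subhom h -> (forall i, 0 < w i) ->
  (forall i, 0 < w' i) -> 0 < h w -> 0 < h w'.
Proof.
move=> [h0 [k hk]] w_gt0 w'_gt0 hw.
pose lam := 1 + \sum_i (w i / w' i + w' i / w i).
have t0 i : 0 <= w i / w' i + w' i / w i by rewrite addr_ge0 // divr_ge0 // ltW.
have lam1 : 1 <= lam by rewrite lerDl sumr_ge0.
have le_lam i : w i / w' i + w' i / w i <= lam.
  by rewrite /lam (bigD1 i) //= addrCA lerDl addr_ge0 // sumr_ge0.
have := hk lam w w' lam1 w_gt0 w'_gt0.
rewrite lt_neqAle h0 // andbT => H; apply/eqP => e.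
move: H; rewrite -e mulr0 leNgt hw => H; suff : false by [].
apply: H => i; rewrite -ler_pdivrMr //; apply: le_trans (le_lam i).
  by rewrite lerDl divr_ge0 // ltW.
by rewrite lerDr divr_ge0 // ltW.
Qed.

End Thompson.

(** * Growth and Lipschitz bounds above the initial weight *)

Section Tame.
Variables (R : realType) (I : finType) (w0 : I -> R).
Hypothesis w0_gt0 : forall i, 0 < w0 i.
Implicit Types (w : I -> R) (h g : (I -> R) -> R).

Lemma above_gt0 w : above w0 w -> forall i, 0 < w i.
Proof. by move=> ww i; exact: lt_le_trans (ww i). Qed.

(** With [S] the sum and [N] the distance, [w i - w' i <= N], while [w' i >= w0 i] makes
    [S * w' i >= 1]. *)
Lemma thompson_le_l1 w w' i : above w0 w -> above w0 w' ->
  w i <= (1 + (\sum_i (w0 i)^-1) * l1norm (fun i => w i - w' i)) * w' i.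
Proof.
move=> ww ww'; set N := l1norm _; set S := \sum_i _.
have N0 : 0 <= N by exact: l1norm_ge0.
have wN : w i - w' i <= N.
  apply: le_trans (ler_norm _) _.
  by rewrite /N /l1norm (bigD1 i) //= lerDl sumr_ge0.
have Sw : 1 <= S * w' i.
  apply: (@le_trans _ _ ((w0 i)^-1 * w' i)).
    by rewrite mulrC ler_pdivlMr // mul1r.
  rewrite ler_pM2r ?(above_gt0 ww') // /S (bigD1 i) //= lerDl sumr_ge0 // => j _.
  by rewrite invr_ge0 ltW.
rewrite mulrDl mul1r -lerBlDl; apply: le_trans wN _.
by rewrite mulrAC ler_peMl.
Qed.

(** By [thompson_le_l1] one may take [lam = 1 + S * N], and then [ln (lam ^+ k) <= k * S * N]. *)
Lemma ln_subhom_lipschitz h : subhom h ->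
  exists2 C : R, 0 <= C & forall w w', above w0 w -> above w0 w' ->
    `|ln (h w) - ln (h w')| <= C * l1norm (fun i => w i - w' i).
Proof.
move=> hh; have [h0 [k hk]] := hh.
set S := \sum_i (w0 i)^-1.
have S0 : 0 <= S by apply: sumr_ge0 => i _; rewrite invr_ge0 ltW.
have kS0 : 0 <= k%:R * S by rewrite mulr_ge0.
exists (k%:R * S) => // w w' ww ww'.
have sym u v : l1norm (fun i => u i - v i) = l1norm (fun i => v i - u i).
  by apply: eq_bigr => i _; rewrite distrC.
have wp := above_gt0 ww; have wp' := above_gt0 ww'.
(* A zero of [h] in the orthant makes [h] vanish on all of it, so the two logarithms agree. *)
have [hw|hw] := ltP 0 (h w); last first.
  have zero u : above w0 u -> h u = 0.
    move=> /above_gt0 up; apply/eqP; rewrite eq_le h0 // andbT leNgt.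
    by apply/negP => /(subhom_gt0 hh up wp); rewrite ltNge hw.
  by rewrite !zero // subrr normr0 mulr_ge0 // l1norm_ge0.
have half u v : above w0 u -> above w0 v ->
    ln (h u) - ln (h v) <= k%:R * S * l1norm (fun i => u i - v i).
  move=> uu vv; have up := above_gt0 uu; have vp := above_gt0 vv.
  have hv : 0 < h v by exact: subhom_gt0 hw.
  have hu : 0 < h u by exact: subhom_gt0 hw.
  set N := l1norm _; have SN : 0 <= S * N by rewrite mulr_ge0 // l1norm_ge0.
  have lam0 : 0 < 1 + S * N by rewrite ltr_pwDl.
  have : h u <= (1 + S * N) ^+ k * h v.
    apply: hk => // [|i|i]; first by rewrite lerDl.
      exact: thompson_le_l1.
    by rewrite /N sym //; exact: thompson_le_l1.
  rewrite -ler_ln ?posrE // ?mulr_gt0 ?exprn_gt0 //.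
  rewrite lnM ?posrE ?exprn_gt0 // lnXn // -lerBlDr => /le_trans; apply.
  rewrite -[ln _ *+ _]mulr_natl -mulrA ler_wpM2l // le_ln1Dx //.
  exact: lt_le_trans SN.
rewrite ler_norml; apply/andP; split; last exact: half.
by rewrite lerNl opprB sym //; exact: half.
Qed.

(** From [ln r <= r - 1] at [r = b / a], after arranging [b <= a]. *)
Lemma dist_le_ln (a b C : R) : 0 < a <= C -> 0 < b <= C ->
  `|a - b| <= C * `|ln a - ln b|.
Proof.
wlog ba : a b / b <= a => [hw aC bC|/andP[a0 aC] /andP[b0 bC]].
  have [ba|/ltW ab] := leP b a; first exact: hw.
  by rewrite distrC (distrC (ln a)); exact: hw.
have C0 : 0 <= C by rewrite (le_trans _ aC) // ltW.
rewrite !ger0_norm ?subr_ge0 ?ler_ln ?posrE //.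
apply: (@le_trans _ _ (a * (ln a - ln b))); last first.
  by rewrite ler_wpM2r // subr_ge0 ler_ln ?posrE.
have : -1 < b / a - 1 by rewrite ltrBrDr addNr divr_gt0.
move=> /le_ln1Dx; rewrite addrCA subrr addr0 ln_div ?posrE //.
rewrite -lerN2 opprB opprB => /(ler_wpM2l (ltW a0)).
by rewrite mulrBr mulr1 mulrCA divff ?gt_eqF // mulr1.
Qed.

(** Bundles what [CauchyProblem] asks of the growth and regularity of one component of the field. *)
Definition tame g : Prop := exists2 K : R, 0 <= K &
  (forall w, above w0 w -> `|g w| <= K * (1 + l1norm w)) /\
  (forall w w', above w0 w -> above w0 w' ->
    `|g w - g w'| <= K * (1 + l1norm w) * l1norm (fun i => w i - w' i)).

Lemma tame_sum (J : Type) (r : seq J) (P : pred J) (h : J -> (I -> R) -> R) :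
  (forall j, tame (h j)) -> tame (fun w => \sum_(j <- r | P j) h j w).
Proof.
move=> hh; elim: r => [|j r [K K0 [Kb Kl]]].
  exists 0 => //; split=> [w _|w w' _ _].
    by rewrite big_nil normr0 mul0r.
  by rewrite !big_nil subrr normr0 !mul0r.
under eq_fun do rewrite big_cons; case: (P j); last by exists K.
have [L L0 [Lb Ll]] := hh j; exists (L + K); first by rewrite addr_ge0.
split=> [w ww|w w' ww ww'].
  by rewrite mulrDl (le_trans (ler_normD _ _)) // lerD ?Lb ?Kb.
rewrite opprD addrACA (le_trans (ler_normD _ _)) //.
by rewrite -mulrA [leRHS]mulrDl !mulrA lerD ?Ll ?Kl.
Qed.

(** [a] is bounded and Lipschitz, [ln b] is Lipschitz and so of linear growth. Splitting the
    difference with [ln b] evaluated at [w] makes the Lipschitz constant depend on [l1norm w]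
    alone. *)
Lemma tame_mul_ln a b (C : R) : subhom a -> subhom b ->
  (forall w, above w0 w -> a w <= C) -> tame (fun w => a w * ln (b w)).
Proof.
move=> ha hb aC.
have C0 : 0 <= C.
  have ww : above w0 w0 by move=> i; exact: lexx.
  by apply: le_trans (aC _ ww); have [a0 _] := ha; exact: a0.
have a0 w : above w0 w -> 0 <= a w by move=> /above_gt0; exact: ha.1.
have [Ca Ca0 aL] := ln_subhom_lipschitz ha.
have [Cb Cb0 bL] := ln_subhom_lipschitz hb.
pose N w w' := l1norm (fun i => w i - w' i).
have N0 w w' : 0 <= N w w' by exact: l1norm_ge0.
have aN w w' : above w0 w -> above w0 w' -> `|a w - a w'| <= C * Ca * N w w'.
  move=> ww ww'; have wp := above_gt0 ww; have wp' := above_gt0 ww'.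
  have [aw|aw] := ltP 0 (a w); last first.
    have zero u : above w0 u -> a u = 0.
      move=> uu; apply/eqP; rewrite eq_le a0 // andbT leNgt.
      by apply/negP => /(subhom_gt0 ha (above_gt0 uu) wp); rewrite ltNge aw.
    by rewrite !zero // subrr normr0 !mulr_ge0.
  have aw' : 0 < a w' by exact: subhom_gt0 aw.
  apply: le_trans (@dist_le_ln _ _ C _ _) _; rewrite ?aw ?aw' ?aC //.
  by rewrite -mulrA ler_wpM2l // aL.
(* [ln b] is compared with its value at [w0], using [|w| + |w0| <= (1 + |w0|) * (1 + |w|)]. *)
pose M := `|ln (b w0)| + Cb * (1 + l1norm w0).
have M0 : 0 <= M by rewrite addr_ge0 // mulr_ge0 // addr_ge0 // l1norm_ge0.
have bM w : above w0 w -> `|ln (b w)| <= M * (1 + l1norm w).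
  move=> ww; have ww0 : above w0 w0 by move=> i; exact: lexx.
  have : N w w0 <= l1norm w + l1norm w0.
    by rewrite -big_split /=; apply: ler_sum => i _; exact: ler_normB.
  have := bL _ _ ww ww0; rewrite -/(N w w0).
  have -> : `|ln (b w)| = `|ln (b w) - ln (b w0) + ln (b w0)| by rewrite subrK.
  move=> H1 H2; apply: le_trans (ler_normD _ _) _.
  rewrite /M mulrDl addrC lerD //.
    by rewrite ler_peMr // lerDl l1norm_ge0.
  apply: le_trans H1 _; rewrite -mulrA ler_wpM2l //; apply: le_trans H2 _.
  have := l1norm_ge0 w; have := l1norm_ge0 w0.
  move: (l1norm w) (l1norm w0) => x y y0 x0.
  by rewrite mulrDl mul1r mulrDr mulr1; have := mulr_ge0 y0 x0; lra.
(* The first term is for the growth, the other two for the two halves of the product rule. *)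
exists (C * M + C * Ca * M + C * Cb).
  by rewrite !addr_ge0 // !mulr_ge0.
have aCn w : above w0 w -> `|a w| <= C.
  by move=> ww; rewrite ger0_norm ?a0 // aC.
split=> [w ww|w w' ww ww'].
  apply: (@le_trans _ _ (C * M * (1 + l1norm w))).
    by rewrite normrM -mulrA ler_pM ?aCn ?bM.
  have L0 : 0 <= 1 + l1norm w by rewrite addr_ge0 // l1norm_ge0.
  by rewrite ler_wpM2r // -addrA lerDl addr_ge0 // !mulr_ge0.
have -> : a w * ln (b w) - a w' * ln (b w') =
   (a w - a w') * ln (b w) + a w' * (ln (b w) - ln (b w')) by ring.
rewrite -/(N w w') (le_trans (ler_normD _ _)) // !normrM.
apply: (@le_trans _ _ (C * Ca * N w w' * (M * (1 + l1norm w)) + C * (Cb * N w w'))).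
  by rewrite lerD // ler_pM ?aN ?bM ?aCn ?bL.
have l0 := l1norm_ge0 w; rewrite -subr_ge0.
have -> : (C * M + C * Ca * M + C * Cb) * (1 + l1norm w) * N w w' -
   (C * Ca * N w w' * (M * (1 + l1norm w)) + C * (Cb * N w w')) =
  C * M * (1 + l1norm w) * N w w' + C * Cb * l1norm w * N w w' by ring.
by rewrite addr_ge0 // !mulr_ge0 // addr_ge0.
Qed.

End Tame.

(** * Distance layers in a connected graph *)

Section Graphs.
Variables (V : finType) (E : {set {set V}}).

Lemma adj_sym : symmetric (adj E).
Proof. by move=> x y; rewrite /adj finset.setUC. Qed.

Lemma adj_neq : simple_graph E -> forall x y, adj E x y -> x != y.
Proof. by move=> simpleE x y /simpleE; rewrite cards2; case: eqP. Qed.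

Lemma nbr1P x z : adj E x z -> x != z -> z \in nbr E x 1.
Proof.
move=> xz neq; rewrite /= inE /adj_set inE eq_sym neq /=.
by apply/existsP; exists x; rewrite inE eqxx adj_sym.
Qed.

(** Connectedness excludes the default value of [level]: along a path from [x], each edge raises the
    radius of a ball containing the current vertex by at most one. *)
Lemma nbr_level : connected_graph E -> forall x z, z \in nbr E x (level E x z).
Proof.
move=> connE x z; suff [j zj] : exists j, z \in nbr E x j by rewrite (levelP zj).
suff [j] : exists j, z \in Defs.ball E x j.
  by rewrite Defs.ballE => /finset.bigcupP[k _ zk]; exists k.
have /connectP[p + ->] := connE x z.
suff reach y j : y \in Defs.ball E x j -> path (adj E) y p ->
    exists k, last y p \in Defs.ball E x k.
  by apply: (reach x 0%N); rewrite /= inE.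
elim: p y j => [|y' p IHp] y j yj /=; first by exists j.
move=> /andP[yy' path_p]; apply: (IHp y' j.+1) => //=.
rewrite !inE /adj_set; case: (y' \in _) => //=.
by apply/existsP; exists y; rewrite yj adj_sym.
Qed.

End Graphs.

(** * Walk probabilities and lower bounds on the entropy *)

Section EntropyEstimates.
Variables (R : realType) (V : finType) (E : {set {set V}}).
Hypotheses (simpleE : simple_graph E) (connE : connected_graph E).
Variable alpha : R.
Hypothesis alpha01 : 0 < alpha < 1.
Implicit Types (w : edge E -> R) (f : edge E) (x y z : V).

Let alpha_gt0 : 0 < alpha. Proof. by case/andP: alpha01. Qed.
Let alpha_le1 : alpha <= 1. Proof. by case/andP: alpha01 => _ /ltW. Qed.
Let onem_gt0 : 0 < 1 - alpha. Proof. by rewrite subr_gt0; case/andP: alpha01. Qed.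

Lemma subhom_pair_weight x y :
  subhom (fun w : edge E -> R => pair_weight w x y).
Proof.
rewrite /pair_weight; case: insub => [f|]; first exact: subhom_coord.
exact: subhom_cst.
Qed.

(** Levels and neighbor sets depend on the graph alone, so every case distinction is independent of
    [w]. *)
Lemma subhom_lazy_walk x z : subhom (fun w => lazy_walk alpha w x z).
Proof.
rewrite /lazy_walk; case: eqP => _; first exact/subhom_cst/ltW.
apply: subhomM.
  apply: subhom_cst; rewrite mulr_ge0 ?exprn_ge0 ?(ltW onem_gt0) //.
  by case: ifP => // _; apply: ltW.
apply: subhom_sum => p; apply: subhom_prod => k; apply: subhomM.
  exact: subhom_pair_weight.
by apply: subhomV; apply: subhom_sum => u; exact: subhom_pair_weight.
Qed.

Lemma lazy_walk_ge0 w x z : (forall f, 0 < w f) -> 0 <= lazy_walk alpha w x z.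
Proof. by case: (subhom_lazy_walk x z) => + _; apply. Qed.

Lemma pair_weight_ge0 w x y : (forall f, 0 < w f) -> 0 <= pair_weight w x y.
Proof. by case: (subhom_pair_weight x y) => + _; apply. Qed.

Lemma step_prob_itv w (A : {set V}) x y : (forall f, 0 < w f) -> y \in A ->
  0 <= pair_weight w x y / \sum_(u in A) pair_weight w x u <= 1.
Proof.
move=> w_gt0 yA; have w_ge0 u : 0 <= pair_weight w x u by exact: pair_weight_ge0.
have : 0 <= \sum_(u in A) pair_weight w x u by exact: sumr_ge0.
rewrite le_eqVlt => /predU1P[<-|S_gt0]; first by rewrite invr0 mulr0 lexx ler01.
rewrite divr_ge0 ?(ltW S_gt0) //= ler_pdivrMr // mul1r.
by rewrite (bigD1 y) //= lerDl sumr_ge0.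
Qed.

(** Counting tuples, each of weight at most [1], is enough: [tame_mul_ln] accepts any bound
    independent of [w]. *)
Lemma outward_prob_le w x z : (forall f, 0 < w f) ->
  outward_prob w x z <= #|{: (level E x z).+1.-tuple V}|%:R.
Proof.
move=> w_gt0.
apply: (@le_trans _ _
  (\sum_(p : (level E x z).+1.-tuple V | outward_path E x z _ p) 1)).
  apply: ler_sum => p /and4P[_ /eqP pz /forallP p_nbr _].
  apply: prodr_ile1 => k _; apply: step_prob_itv => //.
  (* [outward_path] places only interior vertices in their layers; the endpoint is in its layer by
     [nbr_level]. *)
  have := ltn_ord k; rewrite leq_eqVlt => /predU1P[e|kl].
    by rewrite e pz; exact: nbr_level.
  by have /implyP/(_ isT) := p_nbr (Ordinal kl).
by rewrite sumr_const ler_nat max_card.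
Qed.

Lemma lazy_walk_bounded x z :
  exists C : R, forall w, (forall f, 0 < w f) -> lazy_walk alpha w x z <= C.
Proof.
exists (1 + #|{: (level E x z).+1.-tuple V}|%:R) => w w_gt0.
rewrite /lazy_walk; case: eqP => _; first by rewrite ler_wpDr.
apply: (@le_trans _ _ (outward_prob w x z)); last first.
  by rewrite ler_wpDl // outward_prob_le.
have P0 : 0 <= outward_prob w x z.
  apply: sumr_ge0 => p _; apply: prodr_ge0 => k _.
  by rewrite divr_ge0 ?sumr_ge0 // => *; exact: pair_weight_ge0.
rewrite ler_piMl // mulr_ile1 //.
- by rewrite exprn_ge0 // ltW.
- by case: ifP => // _; exact: ltW.
- by rewrite exprn_ile1 ?(ltW onem_gt0) ?gerBl ?(ltW alpha_gt0).
- by case: ifP.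
Qed.

Lemma tame_edge_entropy (w0 : edge E -> R) f : (forall f, 0 < w0 f) ->
  tame w0 (fun w => edge_entropy alpha w f).
Proof.
move=> w0_gt0; apply: tame_sum => x; apply: tame_sum => y; apply: tame_sum => z.
have [C walkC] := lazy_walk_bounded x z.
apply: (tame_mul_ln w0_gt0 (C := C)).
- exact: subhom_lazy_walk.
- by apply: subhomM; [|apply: subhomV]; exact: subhom_lazy_walk.
- by move=> w /(above_gt0 w0_gt0); exact: walkC.
Qed.

(* Holds for [a = 0] or [b = 0] too: both summands are then [0] as [x / 0 = 0]
   and [ln 0 = 0]. *)
Lemma jeffreys_ge0 (a b : R) : 0 <= a -> 0 <= b ->
  0 <= a * ln (a / b) + b * ln (b / a).
Proof.
rewrite le_eqVlt => /predU1P[<- _|a0].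
  by rewrite !mul0r invr0 mulr0 ln0 // mulr0 addr0.
rewrite le_eqVlt => /predU1P[<-|b0].
  by rewrite !mul0r invr0 mulr0 ln0 // mulr0 addr0.
rewrite !ln_div ?posrE //.
have -> : a * (ln a - ln b) + b * (ln b - ln a) = (a - b) * (ln a - ln b) by ring.
have [ab|/ltW ba] := leP a b.
  by rewrite mulr_le0 // subr_le0 // ler_ln ?posrE.
by rewrite mulr_ge0 // subr_ge0 // ler_ln ?posrE.
Qed.

Lemma edgeP f : exists x y, [/\ val f = [set x; y]%SET, x != y & adj E x y].
Proof.
have /eqP/cards2P[x [y [xy e]]] := simpleE (valP f).
by exists x, y; split => //; rewrite /adj -e (valP f).
Qed.

(** Pairing the two divergences vertex by vertex makes each summand nonnegative by [jeffreys_ge0],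
    so a single vertex gives a lower bound. *)
Lemma edge_entropy_sum w f x y : val f = [set x; y]%SET -> x != y ->
  edge_entropy alpha w f = \sum_z
    (lazy_walk alpha w x z * ln (lazy_walk alpha w x z / lazy_walk alpha w y z) +
     lazy_walk alpha w y z * ln (lazy_walk alpha w y z / lazy_walk alpha w x z)).
Proof. by move=> fxy xy; rewrite (edge_entropyE _ _ fxy xy) big_split. Qed.

Lemma edge_entropy_ge0 w f : (forall f, 0 < w f) -> 0 <= edge_entropy alpha w f.
Proof.
move=> w_gt0; have [x [y [fxy xy _]]] := edgeP f.
rewrite (edge_entropy_sum _ fxy xy) sumr_ge0 // => z _.
by rewrite jeffreys_ge0 // lazy_walk_ge0.
Qed.

Lemma pair_weight_edge w f x y : val f = [set x; y]%SET -> pair_weight w x y = w f.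
Proof. by move=> fxy; rewrite /pair_weight -fxy valK. Qed.

Lemma outward_prob_adj w x z : adj E x z ->
  outward_prob w x z = pair_weight w x z / \sum_(u in nbr E x 1) pair_weight w x u.
Proof.
move=> xz; rewrite /outward_prob (levelP (nbr1P xz (adj_neq simpleE xz))).
rewrite (big_pred1 [tuple x; z]) => [|p]; first by rewrite big_ord1.
case: p => -[|a [|b [|c s]]] // p2.
apply/and4P/eqP => [[/eqP /= ax /eqP /= bz _ _]|/(congr1 val) /= [-> ->]].
  by apply: val_inj; rewrite /= ax bz.
split=> //=; first by apply/forallP => -[[|k]].
by apply/forallP => -[[|k] //] i.
Qed.

(* As [w f / w g] tends to [0], the walk from [x] leaves through [f] with
   probability tending to [0], while the walk from [z] stays at [z] with
   probability [alpha]. *)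
Lemma edge_entropy_ge w f g x y z : (forall f, 0 < w f) ->
  val f = [set x; z]%SET -> val g = [set x; y]%SET ->
  2 * w f <= alpha * w g ->
  alpha / 2 * ln 2 <= edge_entropy alpha w f.
Proof.
move=> w_gt0 fxz gxy fg.
have axz : adj E x z by rewrite /adj -fxz (valP f).
have axy : adj E x y by rewrite /adj -gxy (valP g).
have xz := adj_neq simpleE axz.
rewrite (edge_entropy_sum _ fxz xz) (bigD1 z) //=.
apply: ler_wpDr.
  by apply: sumr_ge0 => u _; rewrite jeffreys_ge0 // lazy_walk_ge0.
rewrite [lazy_walk alpha w z z]/lazy_walk eqxx; set a := lazy_walk alpha w x z.
pose P := outward_prob w x z.
have S_ge : w g <= \sum_(u in nbr E x 1) pair_weight w x u.
  rewrite (bigD1 y) ?nbr1P ?(adj_neq simpleE axy) //= (pair_weight_edge _ gxy).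
  by rewrite lerDl sumr_ge0 // => u _; exact: pair_weight_ge0.
have S_gt0 := lt_le_trans (w_gt0 g) S_ge.
have P_gt0 : 0 < P by rewrite /P outward_prob_adj // (pair_weight_edge _ fxz) divr_gt0.
have P_le : P <= alpha / 2.
  rewrite /P outward_prob_adj // (pair_weight_edge _ fxz) ler_pdivrMr //.
  by have := ler_wpM2l (ltW alpha_gt0) S_ge; move: (alpha * _) fg => *; lra.
have a_gt0 : 0 < a.
  rewrite /a /lazy_walk eq_sym (negbTE xz) !mulr_gt0 ?exprn_gt0 //.
  by case: ifP.
have a_le : a <= alpha / 2.
  apply: le_trans P_le; rewrite /a /lazy_walk eq_sym (negbTE xz).
  rewrite ler_piMl ?(ltW P_gt0) //.
  rewrite mulr_ile1 ?exprn_ge0 ?(ltW onem_gt0) //.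
  - by case: ifP => // _; exact: ltW.
  - by rewrite exprn_ile1 ?(ltW onem_gt0) ?gerBl ?(ltW alpha_gt0).
  - by case: ifP.
rewrite !ln_div ?posrE //.
(* Since [a <= alpha / 2], the first factor is at least [alpha / 2] and the second at least
   [ln 2]. *)
have -> : a * (ln a - ln alpha) + alpha * (ln alpha - ln a) =
  (alpha - a) * (ln alpha - ln a) by ring.
have ln_le : ln 2 <= ln alpha - ln a.
  rewrite -lerBlDr opprK -lnM ?posrE // ler_ln ?posrE ?mulr_gt0 //.
  by rewrite mulrC; lra.
apply: ler_pM => //; last by lra.
  by rewrite divr_ge0 // ltW.
by rewrite ln_ge0 // ler1n.
Qed.

End EntropyEstimates.

(** * Dichotomy for the entropy flow *)

Section EntropyFlow.
Variables (R : realType) (V : finType) (E : {set {set V}}).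
Hypotheses (simpleE : simple_graph E) (connE : connected_graph E).
Variable alpha : R.
Hypothesis alpha01 : 0 < alpha < 1.
Variable w0 : edge E -> R.
Hypothesis w0_gt0 : forall f, 0 < w0 f.

(** The constants of all edges are summed; adding [1] makes the result positive even without
    edges. *)
Lemma edge_entropy_field : exists2 K : R, 0 < K &
  (forall w f, above w0 w -> edge_entropy alpha w f <= K * (1 + l1norm w)) /\
  (forall w w' f, above w0 w -> above w0 w' ->
    `|edge_entropy alpha w f - edge_entropy alpha w' f| <=
    K * (1 + l1norm w) * l1norm (fun f => w f - w' f)).
Proof.
have /choice[K KP] : forall f, exists K : R, 0 <= K /\
    ((forall w, above w0 w -> `|edge_entropy alpha w f| <= K * (1 + l1norm w)) /\
     (forall w w', above w0 w -> above w0 w' ->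
       `|edge_entropy alpha w f - edge_entropy alpha w' f| <=
       K * (1 + l1norm w) * l1norm (fun f => w f - w' f))).
  move=> f; have [K K0 KP] := tame_edge_entropy connE alpha01 f w0_gt0.
  by exists K.
have K0 f : 0 <= K f by case: (KP f).
have KS f : K f <= 1 + \sum_g K g.
  by rewrite (bigD1 f) //= addrCA lerDl addr_ge0 // sumr_ge0.
exists (1 + \sum_g K g); first by rewrite ltr_pwDl // sumr_ge0.
have n0 (w : edge E -> R) : 0 <= 1 + l1norm w by rewrite addr_ge0 // l1norm_ge0.
split=> [w f ww|w w' f ww ww'].
  have [_ [Kb _]] := KP f.
  by rewrite (le_trans (ler_norm _)) // (le_trans (Kb _ ww)) // ler_wpM2r.
have [_ [_ Kl]] := KP f; apply: le_trans (Kl _ _ ww ww') _.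
by rewrite !ler_wpM2r // l1norm_ge0.
Qed.

(** * Monotonicity and long-time behavior of a solution *)

Section Solution.
Variable w : R -> edge E -> R.
Hypothesis flow_w : flow_solution alpha w0 w.

Let cw f (s t : R) : 0 <= s -> {within `[s, t], continuous (w ^~ f)}.
Proof.
move=> s0; have [cw _ _ _] := flow_w; apply: continuous_subspaceW (cw f) => r /=.
by rewrite !in_itv /= andbT => /andP[/(le_trans s0)].
Qed.

Let Dw f (t : R) : 0 < t -> is_derive t 1 (w ^~ f) (edge_entropy alpha (w t) f).
Proof. by have [_ Dw _ _] := flow_w; exact: Dw. Qed.

Let w_gt0 f (t : R) : 0 < t -> 0 < w t f.
Proof. by have [_ _ w_gt0 _] := flow_w; exact: w_gt0. Qed.

(** Used with [c = 0] for monotonicity and with [c > 0] for unboundedness. *)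
Lemma flow_increment_ge f (c s t : R) : 0 <= s <= t ->
  (forall r, s < r -> c <= edge_entropy alpha (w r) f) ->
  c * (t - s) <= w t f - w s f.
Proof.
move=> /andP[s0 st] ce; rewrite mulrBr.
have D (r : R) : is_derive r 1 (fun r => c * r) c.
  by have := is_deriveZ c (is_derive_id r 1); rewrite /GRing.scale /= mulr1.
have cc : {within `[s, t], continuous (fun r => c * r)}.
  by apply: continuous_subspaceT => r; apply: cvgMr; exact: cvg_id.
apply: (@increment_le _ (fun r => c * r) (w ^~ f) (fun=> c) _ _ _ st cc (@cw f s t s0)
  (fun r _ => D r) (fun r rst => Dw f (le_lt_trans s0 (andP rst).1))) => r /andP[sr _].
exact: ce.
Qed.

Lemma flow_homo f (s t : R) : 0 <= s <= t -> w s f <= w t f.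
Proof.
move=> st; rewrite -subr_ge0 -[0](mul0r (t - s)).
apply: flow_increment_ge => // r sr; apply: (edge_entropy_ge0 simpleE alpha01) => g.
by apply: w_gt0; apply: le_lt_trans sr; case/andP: st.
Qed.

Lemma flow_above (t : R) : 0 <= t -> above w0 (w t).
Proof.
move=> t0 f; have [_ _ _ <-] := flow_w.
by apply: flow_homo; rewrite lexx.
Qed.

Definition bounded_edge f := exists M, forall t, 0 <= t -> w t f <= M.

Lemma unbounded_edge f (c T : R) : 0 < c -> 0 <= T ->
  (forall t, T < t -> c <= edge_entropy alpha (w t) f) -> ~ bounded_edge f.
Proof.
move=> c0 T0 ce [M wM].
have MT : 0 <= M - w T f + 1 by rewrite addr_ge0 // subr_ge0 wM.
(* Growth at rate [c] from time [T] on brings the weight to at least [M + 1] at this time. *)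
pose t := T + (M - w T f + 1) / c.
have Tt : T <= t by rewrite lerDl divr_ge0 // ltW.
have := flow_increment_ge (t := t) (f := f) _ ce.
rewrite T0 Tt => /(_ isT); rewrite /t addrAC subrr add0r mulrC divfK ?gt_eqF //.
by have := wM t (le_trans T0 Tt); rewrite -/t; lra.
Qed.

(** By monotonicity a level once reached is never left, and a level never reached would be a
    bound. *)
Lemma unbounded_edge_ge f (A : R) : ~ bounded_edge f ->
  exists2 T : R, 0 <= T & forall t, T <= t -> A <= w t f.
Proof.
move=> unb; apply: contrapT => noT; apply: unb; exists A => T T0.
rewrite leNgt; apply/negP => /ltW AT; apply: noT; exists T => // t Tt.
by apply: le_trans AT _; apply: flow_homo; rewrite T0.
Qed.

Lemma bounded_edge_adj f g x y z : val f = [set x; z]%SET ->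
  val g = [set x; y]%SET -> bounded_edge f -> bounded_edge g.
Proof.
move=> fxz gxy bf; apply: contrapT => unb; have [M fM] := bf.
have [alpha0 _] := andP alpha01.
(* Beyond this level [2 * w t f <= 2 * M <= alpha * w t g], as [edge_entropy_ge] requires. *)
have [T T0 gA] := unbounded_edge_ge (2 * M / alpha) unb.
have c0 : 0 < alpha / 2 * ln 2 :> R.
  by rewrite mulr_gt0 ?divr_gt0 // ln_gt0 // ltr1n.
apply: (unbounded_edge c0 T0) bf => t Tt; have t0 := le_lt_trans T0 Tt.
apply: (edge_entropy_ge simpleE alpha01 _ fxz gxy) => [h|]; first exact: w_gt0.
have := gA t (ltW Tt); rewrite ler_pdivrMr // [_ * alpha]mulrC; apply: le_trans.
by rewrite ler_pM2l // fM // ltW.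
Qed.

Lemma bounded_edge_all f g : bounded_edge f -> bounded_edge g.
Proof.
move=> bf.
(* This property propagates along a path: the next edge is bounded, hence so are all edges at its
   other end. *)
pose bounded_at x := forall h y, val h = [set x; y]%SET -> bounded_edge h.
have [x [z [fxz _ _]]] := edgeP simpleE f.
have bx : bounded_at x by move=> h y hxy; exact: (bounded_edge_adj fxz hxy bf).
have [a [b [gab _ _]]] := edgeP simpleE g.
suff ba : bounded_at a by exact: (ba _ _ gab).
have /connectP[p + ->] := connE x a.
elim: p x bx {z fxz} => [//|y p IHp] x bx /= /andP[xy]; apply: IHp.
pose h : edge E := exist _ [set x; y]%SET xy.
have bh : bounded_edge h by exact: bx (erefl (val h)).
by move=> k z kyz; apply: (@bounded_edge_adj h k y z x) bh => //=; rewrite finset.setUC.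
Qed.

Lemma bounded_edge_cvg f : bounded_edge f ->
  exists2 l, w0 f <= l & w t f @[t --> +oo] --> l.
Proof.
(* Nothing is known of [w] at negative times; clipping gives a function monotone on the whole line
   with the same limit. *)
move=> [M wM]; pose v (t : R) := w (Num.max t 0) f.
have max0 (t : R) : 0 <= Num.max t 0 by rewrite le_max lexx orbT.
have v_homo : nondecreasing_fun v.
  move=> s t st; apply: flow_homo; rewrite max0 /=.
  by rewrite ge_max !le_max st lexx orbT.
have ubv : has_ubound (range v) by exists M => _ [t _ <-]; exact: wM.
exists (sup (range v)).
  have [_ _ _ <-] := flow_w.
  by apply: (ub_le_sup ubv); exists 0 => //; rewrite /v maxxx.
apply: cvg_trans (nondecreasing_cvgr v_homo ubv).
apply: near_eq_cvg; near=> t; rewrite /v max_l //.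
Unshelve. all: by end_near. Qed.

Lemma flow_dichotomy :
  (forall f, w t f @[t --> +oo] --> +oo) \/
  (exists wstar : edge E -> R,
    [/\ forall f, 0 < wstar f,
        forall f, w t f @[t --> +oo] --> wstar f,
        forall f, edge_entropy alpha (w t) f @[t --> +oo]
                    --> edge_entropy alpha wstar f &
        forall f, edge_entropy alpha wstar f = 0]).
Proof.
(* A graph without edges falls under the first alternative. *)
have [[f0 bf0]|unb] := pselect (exists f, bounded_edge f); last first.
  left=> f; apply/cvgryPge => A.
  have [T _ wA] : exists2 T : R, 0 <= T & forall t, T <= t -> A <= w t f.
    by apply: unbounded_edge_ge => bf; apply: unb; exists f.
  by near=> t; apply: wA; near: t; apply: nbhs_pinfty_ge; rewrite num_real.
have bnd f : bounded_edge f by exact: bounded_edge_all bf0.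
have /choice[wstar wstarP] : forall f, exists l,
    w0 f <= l /\ w t f @[t --> +oo] --> l.
  by move=> f; have [l] := bounded_edge_cvg (bnd f); exists l.
right; exists wstar.
have above_star : above w0 wstar by move=> f; case: (wstarP f).
have star_gt0 := above_gt0 w0_gt0 above_star.
have cvg_w f : w t f @[t --> +oo] --> wstar f by case: (wstarP f).
have [K K0 [_ Klip]] := edge_entropy_field.
have cvg_e f : edge_entropy alpha (w t) f @[t --> +oo] --> edge_entropy alpha wstar f.
  apply: (cvg_field K0 Klip) => //.
  by near=> t; apply: flow_above; near: t; apply: nbhs_pinfty_ge; rewrite num_real.
split=> // f; apply/eqP.
rewrite eq_le (edge_entropy_ge0 simpleE alpha01) // andbT leNgt; apply/negP => e0.
(* Half of a positive limit would eventually bound the entropy from below, and [unbounded_edge]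
   would contradict [bnd]. *)
have e2 : edge_entropy alpha wstar f / 2 < edge_entropy alpha wstar f.
  by rewrite ltr_pdivrMr // ltr_pMr // ltr1n.
have [T [_ eT]] := cvgr_ge _ (cvg_e f) _ e2.
apply: (@unbounded_edge f (edge_entropy alpha wstar f / 2) (Num.max T 0)) (bnd f).
- by rewrite divr_gt0.
- by rewrite le_max lexx orbT.
- by move=> t; rewrite gt_max => /andP[/eT].
Unshelve. all: by end_near. Qed.

End Solution.
End EntropyFlow.

Unset Implicit Arguments.

Theorem theorem2p1 (R : realType) (V : finType) (E : {set {set V}})
    (simpleE : simple_graph E) (connE : connected_graph E)
    (alpha : R) (alpha01 : 0 < alpha < 1)
    (w0 : edge E -> R) (w0_gt0 : forall f, 0 < w0 f) :
  exists w : R -> edge E -> R,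
    [/\ flow_solution alpha w0 w,
        forall w' : R -> edge E -> R, flow_solution alpha w0 w' ->
          forall t : R, 0 <= t -> forall f, w' t f = w t f &
        (forall f, w t f @[t --> +oo] --> +oo) \/
        (exists wstar : edge E -> R,
          [/\ forall f, 0 < wstar f,
              forall f, w t f @[t --> +oo] --> wstar f,
              forall f, edge_entropy alpha (w t) f @[t --> +oo]
                          --> edge_entropy alpha wstar f &
              forall f, edge_entropy alpha wstar f = 0])].
Proof.
have [K K0 [Kgrowth Klip]] := edge_entropy_field connE alpha01 w0_gt0.
have e_ge0 w f : above w0 w -> 0 <= edge_entropy alpha w f.
  by move=> ww; apply: (edge_entropy_ge0 simpleE alpha01); exact: above_gt0 ww.
have [w [ww cw Dw w00 uniq_w]] := cauchy_problem K0 e_ge0 Kgrowth Klip.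
have flow_w : flow_solution alpha w0 w.
  split=> // f; first exact: continuous_subspaceT.
    by move=> t; exact: Dw.
  by move=> t _; exact: (above_gt0 w0_gt0 (ww t)).
exists w; split=> //; last exact: (flow_dichotomy simpleE connE alpha01 w0_gt0 flow_w).
(* [flow_above] supplies the lower bound under which [cauchy_problem] compares [w'] with [w]. *)
move=> w' flow_w'; have [cw' Dw' _ w'00] := flow_w'.
by apply: uniq_w => // t; exact: (flow_above simpleE alpha01 flow_w').
Qed.
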